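(* For every integer $q\ge 3$ there exist pairs of $(q+1)$-regular graphs of groups whose induced edge-indexed (weighted) graphs $(X,w)$ and $(X',w')$ are non-isomorphic but whose zeta functions are identical: $Z_{(X,w)}(u)=Z_{(X',w')}(u)$.
   Context: Graphs have oriented edges $e$ with source $s(e)$, target $t(e)$ and inverse $\overline{e}\neq e$, $\overline{\overline e}=e$, $s(e)=t(\overline e)$. A graph of groups $(X,\mathcal{G})$ is a graph $X$ with groups $G_x$ (vertices), $G_e=G_{\overline e}$ (edges) and monomorphisms $G_e\to G_{t(e)}$; here all groups are finite. The induced edge-indexed (weighted) graph is $(X,w)$ with $w(e)=|G_{s(e)}|/|G_e|$; an isomorphism of weighted graphs is a graph isomorphism preserving $w$. $(X,\mathcal{G})$ is $(q+1)$-regular if its universal covering (Bass–Serre) tree is $(q+1)$-regular, i.e. $\sum_{s(e)=x}w(e)=q+1$ for every vertex $x$. For edges $e,e'$ with $t(e)=s(e')$ put $w(e,e')=w(e')$ if $e'\neq\overline e$ and $w(e,e')=w(e')-1$ if $e'=\overline e$. For a closed path $c=(e_1,\dots,e_n)$ (so $t(e_i)=s(e_{i+1})$, indices mod $n$), $\ell(c)=n$ and $w(c)=\prod_{j\in\mathbb{Z}/n}w(e_j,e_{j+1})$. A cycle is an equivalence class of closed paths under cyclic rotation; it is prime if it is not a proper power. The Bass–Ihara zeta function is $Z_{(X,w)}(u)=\prod_{[c]}(1-w(c)u^{\ell(c)})^{-1}$ over prime cycles $[c]$ of $X$ (as a power series in $u$, for $|u|$ small). *)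

(* Defs.v *)
From HB Require Import structures.
From mathcomp Require Import all_boot all_order all_algebra all_fingroup.

Set Implicit Arguments.
Unset Strict Implicit.
Unset Printing Implicit Defensive.

Import Order.TTheory GRing.Theory Num.Theory.
Local Open Scope ring_scope.

(* Loops and multiple edges are allowed. *)
Record graph := Graph {
  vertex : finType;
  edge : finType;
  source : edge -> vertex;
  target : edge -> vertex;
  einv : edge -> edge;
  einvK : involutive einv;
  einv_neq : forall e, einv e != e;
  source_einv : forall e, source e = target (einv e)
}.

Definition adjacent (X : graph) : rel (vertex X) :=
  [rel x y | [exists e : edge X, (source e == x) && (target e == y)]].

Definition connected_graph (X : graph) : Prop :=
  inhabited (vertex X) /\ (forall x y : vertex X, connect (@adjacent X) x y).

Record weighted_graph := WeightedGraph {
  wg_graph :> graph;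
  weight : edge wg_graph -> rat
}.

(* The groups of e and of its inverse are identified by [egroup_eq]; their
   monomorphisms into vgroup (target e) and vgroup (source e) are unrelated. *)
Record graph_of_groups := GraphOfGroups {
  gg_graph :> graph;
  gg_connected : connected_graph gg_graph;
  vgroup : vertex gg_graph -> finGroupType;
  egroup : edge gg_graph -> finGroupType;
  egroup_eq : forall e, egroup (einv e) = egroup e;
  emono : forall e, {morphism [set: egroup e] >-> vgroup (target e)};
  emono_inj : forall e, ('injm (emono e))%g
}.

Definition induced (G : graph_of_groups) : weighted_graph :=
  @WeightedGraph G (fun e => #|vgroup (source e)|%:R / #|egroup e|%:R).

(* The number of edges starting at a lift of x in the Bass-Serre tree is the
   sum of the indices |G_x| / |G_e| over the edges e starting at x. *)
Definition regular (d : nat) (G : graph_of_groups) : Prop :=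
  forall x : vertex G,
    \sum_(e : edge (induced G) | source e == x) weight e = d%:R.

Definition weighted_isomorphic (X Y : weighted_graph) : Prop :=
  exists (f : vertex X -> vertex Y) (g : edge X -> edge Y),
    [/\ bijective f, bijective g &
      forall e : edge X,
        [/\ source (g e) = f (source e), target (g e) = f (target e),
            g (einv e) = einv (g e)
          & weight (g e) = weight e]].

Section Zeta.

Variable X : weighted_graph.

Definition transition_weight (e e' : edge X) : rat :=
  if e' == einv e then weight e' - 1 else weight e'.

Definition closed_path (c : seq (edge X)) : bool :=
  path.cycle [rel e e' | target e == source e'] c.

(* [ordS] is the cyclic successor: j |-> j + 1 mod n. *)
Definition path_weight (n : nat) (c : n.-tuple (edge X)) : rat :=
  \prod_(j < n) transition_weight (tnth c j) (tnth c (ordS j)).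

Definition proper_power (n : nat) (c : n.-tuple (edge X)) : bool :=
  [exists k : 'I_n.+1, (1 < k)%N &&
    [exists d : (n %/ k).-tuple (edge X),
      closed_path d && (val c == flatten (nseq k (val d)))]].

Definition rotation_class (n : nat) (c : n.-tuple (edge X)) :
    {set n.-tuple (edge X)} :=
  [set [tuple of rot i c] | i : 'I_n].

Definition prime_cycles (n : nat) : {set {set n.-tuple (edge X)}} :=
  [set rotation_class c | c : n.-tuple (edge X)
                        & closed_path c && ~~ proper_power c].

(* The value at any representative; see [cycle_weight_class]. *)
Definition cycle_weight (n : nat) (C : {set n.-tuple (edge X)}) : rat :=
  if [pick c in C] is Some c then path_weight c else 0.

(* (1 - a u^l)^-1 modulo u^(N+1), for l > 0. *)
Definition euler_factor (N l : nat) (a : rat) : {poly rat} :=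
  \sum_(k < N.+1) a ^+ k *: 'X^(k * l).

(* Coefficient of u^n in the Euler product over all prime cycles, as a formal
   power series: the factors of length l > n are 1 modulo u^(n+1), and the
   others may be truncated.  See [zeta_euler_product]. *)
Definition zeta (n : nat) : rat :=
  (\prod_(1 <= l < n.+1) \prod_(C in prime_cycles l)
     euler_factor n l (cycle_weight C))`_n.

Lemma proper_powerP (n : nat) (c : n.-tuple (edge X)) : (0 < n)%N ->
  reflect (exists (k : nat) (d : seq (edge X)),
             [/\ (1 < k)%N, closed_path d & val c = flatten (nseq k d)])
          (proper_power c).
Proof.
move=> n0; apply: (iffP existsP) => [[k /andP[k1 /existsP[d /andP[cd /eqP cE]]]]|].
  by exists k, d.
move=> [k [d [k1 cd cE]]].
have nE : n = (k * size d)%N.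
  rewrite -(size_tuple c) cE size_flatten /shape map_nseq sumn_nseq.
  by rewrite mulnC.
have kn : (k < n.+1)%N.
  by rewrite ltnS nE leq_pmulr //; move: n0; rewrite nE muln_gt0 => /andP[].
have sd : size d == (n %/ Ordinal kn)%N by rewrite /= nE mulKn // ltnW.
exists (Ordinal kn); rewrite /= k1 /=; apply/existsP.
by exists (Tuple sd); rewrite /= cd cE eqxx.
Qed.

Lemma path_weight_rot (n i : nat) (c : n.-tuple (edge X)) :
  path_weight [tuple of rot i c] = path_weight c.
Proof.
have rot1E m (d : m.-tuple (edge X)) :
    path_weight [tuple of rot 1 d] = path_weight d.
  have tE (j : 'I_m) : tnth [tuple of rot 1 d] j = tnth d (ordS j).
    case: m d j => [|m] d j; first by case: j.
    have x0 := tnth d j; rewrite !(tnth_nth x0) /= nth_cat size_drop size_tuple subn1 /=.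
    have := ltn_ord j; rewrite ltnS leq_eqVlt => /orP[/eqP jm|jm].
      rewrite jm ltnn subnn modnn.
      by case/tupleP: d => e d /=; rewrite ?take0.
    by rewrite jm nth_drop add1n modn_small.
  rewrite /path_weight [RHS](reindex_inj (@ordS_inj m)).
  by apply: eq_bigr => j _; rewrite !tE.
have [ic|/rot_oversize ic] := ltnP i (size c); last first.
  by congr path_weight; apply: val_inj; rewrite /= ic.
elim: i ic => [|i IHi] ic.
  by congr path_weight; apply: val_inj; rewrite /= rot0.
rewrite -IHi 1?ltnW // -[RHS]rot1E; congr path_weight; apply: val_inj => /=.
by rewrite -add1n rotD // add1n ltnW.
Qed.

Lemma cycle_weight_class (n : nat) (c : n.-tuple (edge X)) : (0 < n)%N ->
  cycle_weight (rotation_class c) = path_weight c.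
Proof.
move=> n0; rewrite /cycle_weight; case: pickP => [d|/(_ c)].
  by case/imsetP => i _ ->; apply: path_weight_rot.
case/negP; apply/imsetP; exists (Ordinal n0) => //.
by apply: val_inj; rewrite /= rot0.
Qed.

Let congX (N : nat) (p r : {poly rat}) :=
  forall i, (i <= N)%N -> p`_i = r`_i.

Let congX_mul N p1 p2 r1 r2 :
  congX N p1 r1 -> congX N p2 r2 -> congX N (p1 * p2) (r1 * r2).
Proof.
move=> h1 h2 i iN; rewrite !coefM; apply: eq_bigr => j _.
rewrite h1 ?h2 //; first exact: leq_trans (leq_subr _ _) iN.
by apply: leq_trans iN; rewrite -ltnS.
Qed.

Let congX_prod N (I : Type) (s : seq I) (P : pred I) (F H : I -> {poly rat}) :
  (forall i, P i -> congX N (F i) (H i)) ->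
  congX N (\prod_(i <- s | P i) F i) (\prod_(i <- s | P i) H i).
Proof. by move=> FH; apply: big_ind2 => // *; apply: congX_mul. Qed.

Let congX_prod1 N (I : Type) (s : seq I) (P : pred I) (F : I -> {poly rat}) :
  (forall i, P i -> congX N (F i) 1) -> congX N (\prod_(i <- s | P i) F i) 1.
Proof.
move=> F1; elim/big_rec: _ => // i p /F1 Fi p1.
by rewrite -(mulr1 1); apply: congX_mul.
Qed.

Let euler_factorK N l a : (0 < l)%N ->
  congX N (euler_factor N l a * (1 - a *: 'X^l)) 1.
Proof.
move=> l0 i iN; have -> : euler_factor N l a * (1 - a *: 'X^l) =
    1 - (a *: 'X^l) ^+ N.+1.
  rewrite -[in RHS](expr1n _ N.+1) subrXX mulrC; congr (_ * _).
  apply: eq_bigr => k _.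
  by rewrite expr1n mul1r exprZn -exprM mulnC.
rewrite exprZn -exprM coefB coefZ coefXn ltn_eqF ?mulr0 ?subr0 //.
by apply: leq_trans (leq_pmull _ l0); rewrite ltnS.
Qed.

Let euler_factor_trunc n N l a : (0 < l)%N -> (n <= N)%N ->
  congX n (euler_factor N l a) (euler_factor n l a).
Proof.
move=> l0 nN i ni; rewrite /euler_factor.
rewrite -(big_mkord xpredT (fun k => a ^+ k *: 'X^(k * l))).
rewrite (big_cat_nat (leq0n n.+1)) //= big_mkord coefD -[RHS]addr0.
congr (_ + _); rewrite coef_sum big_nat_cond big1 // => k.
rewrite andbT => /andP[nk _]; rewrite coefZ coefXn ltn_eqF ?mulr0 //.
by apply: leq_ltn_trans ni _; apply: leq_trans nk (leq_pmulr _ l0).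
Qed.

Let euler_factor1 n l a : (n < l)%N -> congX n (euler_factor n l a) 1.
Proof.
move=> nl i ni; rewrite /euler_factor big_ord_recl mul0n !expr0 scale1r coefD.
rewrite coef_sum big1 ?addr0 // => k _; rewrite coefZ coefXn ltn_eqF ?mulr0 //.
rewrite /= mulSn; apply: leq_trans (leq_addr _ _).
exact: leq_ltn_trans ni nl.
Qed.

(* Modulo u^(N+1), the series with coefficients [zeta] is inverse to the
   product of the 1 - w(c) u^l(c) over the prime cycles of length at most N. *)
Lemma zeta_euler_product (N i : nat) : (i <= N)%N ->
  ((\poly_(n < N.+1) zeta n) *
   \prod_(1 <= l < N.+1) \prod_(C in prime_cycles l)
      (1 - cycle_weight C *: 'X^l))`_i = (i == 0%N)%:R.
Proof.
move=> iN; rewrite -coef1.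
pose P n := \prod_(1 <= l < n.+1) \prod_(C in prime_cycles l)
     euler_factor n l (cycle_weight C).
have PN : congX N (\poly_(n < N.+1) zeta n) (P N).
  move=> n nN; rewrite coef_poly ltnS nN /zeta -/(P n).
  rewrite /P [in RHS](big_cat_nat (n := n.+1)) //=.
  rewrite -[LHS]/(_`_n) -(mulr1 (\prod_(1 <= l < n.+1) \prod_(C in _)
    euler_factor n _ _)).
  symmetry; apply: (@congX_mul n) => //.
    rewrite !big_nat; apply: congX_prod => l /andP[l0 _].
    by apply: congX_prod => C _; apply: euler_factor_trunc.
  rewrite big_nat; apply: congX_prod1 => l /andP[nl _].
  apply: congX_prod1 => C _ j jn.
  rewrite (euler_factor_trunc _ _ nN) ?(leq_ltn_trans _ nl) //.
  exact: euler_factor1.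
transitivity ((P N * \prod_(1 <= l < N.+1) \prod_(C in prime_cycles l)
      (1 - cycle_weight C *: 'X^l))`_i).
  exact: (congX_mul PN).
rewrite /P -big_split /=; move: i iN; rewrite -/(congX N _ _) big_nat.
apply: congX_prod1 => l /andP[l0 _]; rewrite -big_split /=.
by apply: congX_prod1 => C _; apply: euler_factorK.
Qed.

End Zeta.

(* Main.v *)
(* Take the path with three vertices, with weights m and q + 1 - m on the two
   edges leaving the center and q + 1 on the two others.  Taking the logarithmic
   derivative of the Euler product, the zeta function is determined by the
   traces of the powers of the transition operator T on edges.  Here
   T^4 = q(q-1) T^2 + q^3, and tr T^n does not depend on m for n < 4, hence for
   no n.  The cases m = 1 and m = 2 differ when q >= 3, as only the former has
   an edge of weight 1. *)
Require Import Defs.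
From mathcomp Require Import all_boot all_order all_algebra all_fingroup.
From mathcomp Require Import ring.

Set Implicit Arguments.
Unset Strict Implicit.
Unset Printing Implicit Defensive.

Import Order.TTheory GRing.Theory Num.Theory.
Local Open Scope ring_scope.

(** * Periods of points under injective self-maps of a finite type *)

Lemma order_dvdn (T : finType) (f : T -> T) (x : T) (m : nat) :
  injective f -> (fingraph.order f x %| m)%N = (iter m f x == x).
Proof.
move=> f_inj; have iterM k : iter (k * fingraph.order f x) f x = x.
  by elim: k => // k IHk; rewrite mulSn iterD IHk iter_order.
rewrite {2}(divn_eq m (fingraph.order f x)) addnC iterD iterM /dvdn.
apply/eqP/eqP => [-> //|mx].
rewrite -[LHS](@findex_iter _ f x) ?ltn_mod ?order_gt0 //.
by rewrite mx findex0.
Qed.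

Lemma order_fconnect (T : finType) (f : T -> T) (x y : T) :
  injective f -> fconnect f x y -> fingraph.order f y = fingraph.order f x.
Proof.
move=> f_inj xy; rewrite /fingraph.order; apply: eq_card => z.
by rewrite !inE -(same_connect (fconnect_sym f_inj) xy).
Qed.

(** An injective semiconjugacy neither creates nor destroys periods. It is applied to [d] and its
    powers under rotation. *)
Lemma order_semiconj (S T : finType) (g : S -> S) (f : T -> T) (h : S -> T)
    (x : S) :
  injective g -> injective f -> injective h -> (forall y, f (h y) = h (g y)) ->
  fingraph.order f (h x) = fingraph.order g x.
Proof.
move=> g_inj f_inj h_inj fh.
have iterh m : iter m f (h x) = h (iter m g x) by elim: m => //= m ->.
apply/eqP; rewrite eqn_dvd !order_dvdn // iterh iter_order // eqxx /=.
by rewrite -(inj_eq h_inj) -iterh iter_order.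
Qed.

(** * Powers and rotations of sequences *)

Section Power.

Variable T : eqType.

Lemma flatten_nseq_rcons (k : nat) (x : T) (s : seq T) :
  flatten (nseq k (x :: s)) ++ [:: x] = x :: flatten (nseq k (rcons s x)).
Proof. by elim: k => //= k IHk; rewrite -catA IHk -cats1 -catA. Qed.

Lemma cat_flatten_nseq (k : nat) (s : seq T) :
  flatten (nseq k s) ++ s = flatten (nseq k.+1 s).
Proof. by elim: k => [|k IHk]; rewrite /= ?cats0 // -catA IHk. Qed.

Lemma rot1_flatten_nseq (k : nat) (s : seq T) :
  rot 1 (flatten (nseq k s)) = flatten (nseq k (rot 1 s)).
Proof.
case: s => [|x s]; first by rewrite /rot /=; elim: k => //= k ->.
case: k => [|k] //; rewrite rot1_cons /= rot1_cons -!cats1 -catA.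
rewrite flatten_nseq_rcons.
by rewrite -cats1 -catA.
Qed.

(** Commuting words are powers of a common word; the size condition makes that word [a] itself.
    After a leading [a] is stripped from [b], the rest still commutes with [a]. *)
Lemma flatten_nseq_commute (k : nat) (a b : seq T) :
  a ++ b = b ++ a -> size b = (k * size a)%N -> b = flatten (nseq k a).
Proof.
elim: k b => [|k IHk] b ab; first by move/size0nil.
rewrite mulSn => sb.
have ba : take (size a) b = a.
  have := congr1 (take (size a)) ab.
  by rewrite take_size_cat // takel_cat // sb leq_addr.
rewrite -(cat_take_drop (size a) b) ba /=; congr (_ ++ _).
apply: IHk; last by rewrite size_drop sb addKn.
move: ab; rewrite -{1 2}(cat_take_drop (size a) b) ba -catA => /eqP.
by rewrite eqseq_cat // eqxx /= => /eqP.
Qed.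

(** Invariance under rotation by [l] says that [take l c] and [drop l c] commute. *)
Lemma rot_flatten_nseq (k : nat) (c : seq T) (l : nat) :
  (0 < k)%N -> size c = (k * l)%N -> rot l c = c ->
  c = flatten (nseq k (take l c)).
Proof.
case: k => // k _ sc rc.
have lc : (l <= size c)%N by rewrite sc leq_pmull.
have st : size (take l c) = l by rewrite size_takel.
rewrite -{1}(cat_take_drop l c) /=; congr (_ ++ _).
apply: flatten_nseq_commute; first by rewrite cat_take_drop -[LHS]rc.
by rewrite size_drop st sc mulSn addKn.
Qed.

Lemma cycle_flatten_nseq (r : rel T) (k : nat) (s : seq T) : (0 < k)%N ->
  path.cycle r (flatten (nseq k s)) = path.cycle r s.
Proof.
case: k => // k _; case: s => [|x s]; first by elim: k.
rewrite /= -cats1 -catA flatten_nseq_rcons -cat_rcons cat_path last_rcons.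
have [xs|//] := boolP (path r x (rcons s x)).
by elim: k => //= k IHk; rewrite cat_path xs last_rcons.
Qed.

End Power.

(** * Products along cyclic sequences and traces of powers of a matrix *)

Section PathProduct.

Variables (R : comNzRingType) (E : finType).

Fixpoint path_prod (f : E -> E -> R) (x : E) (s : seq E) : R :=
  if s is y :: s' then f x y * path_prod f y s' else 1.

Definition cycle_prod (f : E -> E -> R) (s : seq E) : R :=
  if s is x :: s' then path_prod f x (rcons s' x) else 1.

Lemma path_prod_cat f x s1 s2 :
  path_prod f x (s1 ++ s2) = path_prod f x s1 * path_prod f (last x s1) s2.
Proof. by elim: s1 x => [|y s1 IHs] x /=; rewrite ?mul1r // IHs mulrA. Qed.

Lemma cycle_prod_flatten_nseq f k s :
  cycle_prod f (flatten (nseq k s)) = cycle_prod f s ^+ k.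
Proof.
case: k => // k; case: s => [|x s]; first by rewrite expr1n; elim: k.
rewrite /= -cats1 -catA flatten_nseq_rcons -cat_rcons path_prod_cat last_rcons.
rewrite exprS; congr (_ * _).
by elim: k => //= k IHk; rewrite path_prod_cat last_rcons IHk exprS.
Qed.

Lemma path_prod_nth f x n s : size s = n ->
  path_prod f x s = \prod_(j < n) f (nth x (x :: s) j) (nth x s j).
Proof.
move=> <-; elim: s x => [|y s IHs] x; first by rewrite big_ord0.
rewrite /= big_ord_recl IHs; congr (_ * _); apply: eq_bigr => j _ /=.
by rewrite !(set_nth_default x y) //= ltnW // ltnS.
Qed.

Lemma cycle_prod_tuple f n (c : n.-tuple E) :
  \prod_(j < n) f (tnth c j) (tnth c (ordS j)) = cycle_prod f c.
Proof.
case: n c => [|n] c; first by rewrite big_ord0 tuple0.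
case/tupleP: c => x s.
have lastE : last x s = nth x (x :: s) n by rewrite (last_nth x) size_tuple.
rewrite /= -cats1 path_prod_cat /= mulr1 big_ord_recr lastE.
rewrite (path_prod_nth f x (size_tuple s)) !(tnth_nth x) /= modnn.
congr (_ * _); apply: eq_bigr => j _.
by rewrite !(tnth_nth x) /= modn_small ?ltnS.
Qed.

Lemma sum_tuple_cons n (F : seq E -> R) :
  \sum_(c : n.+1.-tuple E) F c = \sum_x \sum_(s : n.-tuple E) F (x :: s).
Proof.
rewrite (reindex (fun p : E * n.-tuple E => [tuple of p.1 :: p.2])) /=.
  by rewrite -(pair_bigA _ (fun x (s : n.-tuple E) => F (x :: s))).
exists (fun s => (thead s, [tuple of behead s])) => [[e s]|s] _ /=.
  by congr pair; apply: val_inj.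
by case/tupleP: s => e s; apply: val_inj.
Qed.

Definition kernel_op (f : E -> E -> R) (h : E -> R) (x : E) : R :=
  \sum_y f x y * h y.

Lemma iter_kernel_op f n h x :
  iter n (kernel_op f) h x =
  \sum_(s : n.-tuple E) path_prod f x s * h (last x s).
Proof.
elim: n x => [|n IHn] x /=.
  rewrite (big_pred1 [tuple]) => [|s]; last by apply/esym/eqP; apply: tuple0.
  by rewrite mul1r.
rewrite (sum_tuple_cons n (fun s => path_prod f x s * h (last x s))).
apply: eq_bigr => y _; rewrite IHn big_distrr /=.
by apply: eq_bigr => s _; rewrite mulrA.
Qed.

(* The trace of [f]^n, for [f] read as a matrix indexed by [E]. *)
Definition power_trace (f : E -> E -> R) (n : nat) : R :=
  \sum_x iter n (kernel_op f) (fun y => (y == x)%:R) x.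

(** This is the expansion of the trace of a matrix power over all index sequences. At n = 0 the two
    sides would be 1 and the cardinality of [E]. *)
Lemma sum_cycle_prod f n : (0 < n)%N ->
  \sum_(c : n.-tuple E) cycle_prod f c = power_trace f n.
Proof.
case: n => // n _; rewrite (sum_tuple_cons n (cycle_prod f)).
(* One factor of the operator is applied to the indicator of [x], giving [f y x]: this is the step
   that closes the cycle. *)
apply: eq_bigr => x _; rewrite iterSr iter_kernel_op; apply: eq_bigr => s _.
rewrite /= -cats1 path_prod_cat /= mulr1; congr (_ * _).
rewrite /kernel_op (bigD1 x) //= eqxx mulr1 big1 ?addr0 // => y /negPf->.
by rewrite mulr0.
Qed.

End PathProduct.

(** * Rotation periods of tuples and of their powers *)

Section TuplePower.

Variable E : finType.

Definition tuple_rot1 n (c : n.-tuple E) : n.-tuple E := [tuple of rot 1 c].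

Lemma tuple_rot1_inj n : injective (@tuple_rot1 n).
Proof. by move=> c d /(congr1 val) /= /rot_inj /val_inj. Qed.

Lemma iter_tuple_rot1 n (c : n.-tuple E) i : (i <= n)%N ->
  iter i (@tuple_rot1 n) c = [tuple of rot i c].
Proof.
elim: i => [|i IHi] i_n; apply: val_inj; first by rewrite /= rot0.
by rewrite iterS IHi 1?ltnW //= -rotS ?size_tuple.
Qed.

Lemma order_tuple_rot1 n (c : n.-tuple E) :
  (fingraph.order (@tuple_rot1 n) c %| n)%N.
Proof.
rewrite (order_dvdn _ _ (@tuple_rot1_inj n)) iter_tuple_rot1 //.
by apply/eqP/val_inj; rewrite /= -{1}(size_tuple c) rot_size.
Qed.

Lemma size_flatten_nseq k l (d : l.-tuple E) :
  size (flatten (nseq k (val d))) == (k * l)%N.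
Proof. by rewrite size_flatten /shape map_nseq sumn_nseq size_tuple mulnC. Qed.

Definition tuple_power k l (d : l.-tuple E) : (k * l).-tuple E :=
  Tuple (size_flatten_nseq k d).

Lemma tuple_power_inj k l : (0 < k)%N -> injective (@tuple_power k l).
Proof.
case: k => // k _ c d /(congr1 val) /= /eqP.
by rewrite eqseq_cat ?size_tuple // => /andP[/eqP /val_inj].
Qed.

Lemma order_tuple_power k l (d : l.-tuple E) : (0 < k)%N ->
  fingraph.order (@tuple_rot1 (k * l)) (tuple_power k d) =
  fingraph.order (@tuple_rot1 l) d.
Proof.
move=> k0; apply: order_semiconj (tuple_power_inj k0) _.
- exact: tuple_rot1_inj.
- exact: tuple_rot1_inj.
- by move=> c; apply: val_inj; rewrite /= rot1_flatten_nseq.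
Qed.

Lemma size_take_power k l (c : (k.+1 * l).-tuple E) : size (take l c) == l.
Proof. by rewrite size_takel // size_tuple leq_pmull. Qed.

Lemma tuple_power_take k l (c : (k.+1 * l).-tuple E) :
  (fingraph.order (@tuple_rot1 _) c %| l)%N ->
  tuple_power k.+1 (Tuple (size_take_power c)) = c.
Proof.
rewrite (order_dvdn _ _ (@tuple_rot1_inj _)) iter_tuple_rot1 ?leq_pmull //.
move=> /eqP/(congr1 val) rc; apply: val_inj.
exact/esym/(rot_flatten_nseq (ltn0Sn k) (size_tuple c)).
Qed.

End TuplePower.

(** * Prime cycles and closed paths *)

Section PrimeCycles.

Variable X : weighted_graph.

Let rot1 {n} := @tuple_rot1 (edge X) n.

(** As orbits of a permutation, rotation classes have [fingraph.order] as cardinality, and equality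
    of classes becomes connectedness. *)
Lemma rotation_classE n (c : n.-tuple (edge X)) : (0 < n)%N ->
  rotation_class c = [set d | fconnect rot1 c d].
Proof.
move=> n0; apply/setP => d; rewrite inE; apply/imsetP/idP => [[i _ ->]|cd].
  by rewrite -iter_tuple_rot1 ?fconnect_iter // ltnW.
have ordn : (fingraph.order rot1 c <= n)%N.
  by rewrite dvdn_leq // order_tuple_rot1.
have ltn := leq_trans (findex_max cd) ordn.
exists (Ordinal ltn) => //=.
by rewrite -iter_tuple_rot1 1?ltnW // (iter_findex cd).
Qed.

Lemma closed_path_fconnect n (c d : n.-tuple (edge X)) :
  fconnect rot1 c d -> closed_path d = closed_path c.
Proof.
move=> /iter_findex <-; elim: (findex _ _ _) => //= i <-.
by rewrite /closed_path rot_cycle.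
Qed.

(** Prime means that all n rotations are distinct. If the period is a proper divisor of n, then [c]
    is a power of its initial segment of that length, and this segment is again closed. *)
Lemma proper_power_order n (c : n.-tuple (edge X)) : (0 < n)%N ->
  closed_path c -> ~~ proper_power c = (fingraph.order rot1 c == n).
Proof.
move=> n0 cc; have o_n := order_tuple_rot1 c; apply/idP/eqP => [|oE].
  apply: contraNeq => o_neq; apply/proper_powerP => //.
  case/dvdnP: (o_n) => -[|k] nE; first by rewrite nE in n0.
  have k0 : (0 < k)%N.
    by case: k nE => // nE; case/eqP: o_neq; rewrite [RHS]nE mul1n.
  have cE : c = flatten (nseq k.+1 (take (fingraph.order rot1 c) c)) :> seq _.
    apply: rot_flatten_nseq; rewrite ?size_tuple //.
    have := iter_order (@tuple_rot1_inj _ n) c.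
    by rewrite iter_tuple_rot1 ?(dvdn_leq n0 o_n) // => /(congr1 val).
  exists k.+1, (take (fingraph.order rot1 c) c); split=> //.
  by rewrite /closed_path -(@cycle_flatten_nseq _ _ k.+1) // -cE.
apply/proper_powerP => // -[k [d [k1 cd cE]]].
have nE : n = (k * size d)%N.
  have := size_flatten_nseq k (in_tuple d).
  by rewrite -cE size_tuple => /eqP.
have d_n : (size d < n)%N.
  rewrite nE ltn_Pmull //; case: (posnP (size d)) => // d0.
  by rewrite nE d0 muln0 in n0.
(* Rotation by [size d] fixes a power of [d], so the period n would divide the smaller positive
   number [size d]. *)
have : (n %| size d)%N.
  rewrite -{1}oE (order_dvdn _ _ (@tuple_rot1_inj _ n)).
  rewrite iter_tuple_rot1 1?ltnW //.
  apply/eqP/val_inj; rewrite /= cE.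
  by case: k k1 {cE nE} => // k _; rewrite [LHS]rot_size_cat cat_flatten_nseq.
by rewrite gtnNdvd // lt0n; apply: contraL n0; rewrite nE => /eqP->;
  rewrite muln0.
Qed.

(** The class of a prime closed path has exactly [l] members, all prime, closed and of the same
    weight. *)
Lemma sum_prime_cycles (l : nat) (F : rat -> rat) : (0 < l)%N ->
  \sum_(c : l.-tuple (edge X) | closed_path c && ~~ proper_power c)
    F (path_weight c) =
  \sum_(C in prime_cycles X l) l%:R * F (cycle_weight C).
Proof.
move=> l0; pose A :=
  [set c : l.-tuple (edge X) | closed_path c && ~~ proper_power c].
transitivity (\sum_(c in A) F (path_weight c)).
  by apply: eq_bigl => c; rewrite inE.
have -> : prime_cycles X l = [set rotation_class c | c in A].
  by apply/setP => C; apply/imsetP/imsetP => -[c cA ->]; exists c; move: cA;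
    rewrite // inE.
rewrite (partition_big_imset (@rotation_class X l)).
apply: eq_bigr => _ /imsetP[c cA ->].
transitivity (\sum_(d in rotation_class c) F (cycle_weight (rotation_class c))).
  apply: eq_big => [d|d /andP[_ /eqP <-]]; last by rewrite cycle_weight_class.
  rewrite [in RHS]rotation_classE // [RHS]inE; apply/andP/idP => [[_ /eqP]|cd].
    rewrite !rotation_classE // => dc.
    have : d \in [set x | fconnect rot1 d x] by rewrite inE.
    by rewrite dc inE.
  have := cA; rewrite !inE => /andP[cc].
  rewrite (closed_path_fconnect cd) cc /= !proper_power_order //.
    rewrite (order_fconnect (@tuple_rot1_inj _ l) cd) => ->; split=> //.
    apply/eqP; rewrite !rotation_classE //; apply/setP => e; rewrite !inE.
    by rewrite (same_connect (fconnect_sym (@tuple_rot1_inj _ l)) cd).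
  by rewrite (closed_path_fconnect cd).
rewrite sumr_const mulr_natl; congr (_ *+ _).
move: cA; rewrite inE => /andP[cc]; rewrite proper_power_order // => /eqP oE.
by rewrite -[RHS]oE rotation_classE // cardsE.
Qed.

End PrimeCycles.

(** * Traces of the transition operator as sums over prime cycles *)

Section ClosedPaths.

Variable X : weighted_graph.

(** The transition operator on edges. Its zeros at non-consecutive pairs let sums over all tuples
    count closed paths only. *)
Definition edge_kernel (e e' : edge X) : rat :=
  if target e == source e' then transition_weight e e' else 0.

Lemma cycle_prod_edge_kernel n (c : n.-tuple (edge X)) :
  cycle_prod edge_kernel c = if closed_path c then path_weight c else 0.
Proof.
rewrite /path_weight cycle_prod_tuple /closed_path.
case: (tval c) => [|x s] //=; move: (rcons s x) => t.
elim: t x => [|z t IHt] y //=.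
by rewrite IHt /edge_kernel; case: eqP => _; rewrite ?mul0r //=; case: ifP;
  rewrite ?mulr0.
Qed.

Lemma path_weight_power k l (d : l.-tuple (edge X)) :
  path_weight (tuple_power k d) = path_weight d ^+ k.
Proof.
rewrite /path_weight (cycle_prod_tuple _ (tuple_power k d)) cycle_prod_tuple.
exact: cycle_prod_flatten_nseq.
Qed.

(** Raising to the power [n %/ l] is a bijection from the prime closed paths of length [l] to the
    closed paths of length [n] with rotation period [l]; its inverse is [take l]. *)
Lemma sum_closed_path_order n l : (0 < n)%N -> (l %| n)%N ->
  \sum_(c : n.-tuple (edge X) |
        closed_path c && (fingraph.order (@tuple_rot1 _ n) c == l))
    path_weight c =
  \sum_(C in prime_cycles X l) l%:R * cycle_weight C ^+ (n %/ l).
Proof.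
move=> n0 /dvdnP[[|k] nE]; first by rewrite nE in n0.
have l0 : (0 < l)%N by case: l nE => // nE; rewrite nE muln0 in n0.
rewrite -(sum_prime_cycles X (fun a => a ^+ (n %/ l))) // nE mulnK //.
rewrite (reindex_onto (@tuple_power _ k.+1 l)
  (fun c => Tuple (size_take_power c))) => [|c /andP[_ /eqP cl]]; last first.
  by apply: tuple_power_take; rewrite cl.
apply: eq_big => [d|d _]; last exact: path_weight_power.
rewrite order_tuple_power // /closed_path cycle_flatten_nseq //.
have -> : Tuple (size_take_power (tuple_power k.+1 d)) = d.
  by apply: val_inj; rewrite /= take_size_cat ?size_tuple.
rewrite eqxx andbT; case cd: (path.cycle _ _) => //=.
by rewrite proper_power_order.
Qed.

(* Every closed path is a power of a prime one, of which it has as many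
   rotations as the length of the latter. *)
Lemma power_trace_prime_cycles n N : (0 < n <= N)%N ->
  power_trace edge_kernel n =
  \sum_(1 <= l < N.+1 | (l %| n)%N)
    \sum_(C in prime_cycles X l) l%:R * cycle_weight C ^+ (n %/ l).
Proof.
move=> /andP[n0 nN]; rewrite -sum_cycle_prod //.
under eq_bigr do rewrite cycle_prod_edge_kernel.
rewrite -big_mkcond /=.
(* After the sums are exchanged, each closed path contributes for exactly one [l], its rotation
   period, which divides [n]. *)
under [RHS]eq_bigr => l ln do rewrite -sum_closed_path_order // big_mkcondr.
rewrite exchange_big /=; apply: eq_bigr => c _.
pose o := fingraph.order (@tuple_rot1 _ n) c.
have o_n : (o %| n)%N := order_tuple_rot1 c.
rewrite big_mkcond (bigD1_seq o) ?iota_uniq //=; last first.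
  by rewrite mem_index_iota fingraph.order_gt0 ltnS (leq_trans _ nN) //
    dvdn_leq.
rewrite o_n eqxx big1 ?addr0 // => l; rewrite eq_sym => /negPf ->.
by rewrite if_same.
Qed.

End ClosedPaths.

(** * Logarithmic derivatives of truncated series *)

Section TruncatedSeries.

Variable R : numDomainType.

Definition eq_upto (N : nat) (p r : {poly R}) : Prop :=
  forall i, (i <= N)%N -> p`_i = r`_i.

Lemma eq_uptoM N p1 p2 r1 r2 :
  eq_upto N p1 r1 -> eq_upto N p2 r2 -> eq_upto N (p1 * p2) (r1 * r2).
Proof.
move=> h1 h2 i iN; rewrite !coefM; apply: eq_bigr => j _.
rewrite h1 ?h2 //; first exact: leq_trans (leq_subr _ _) iN.
by apply: leq_trans iN; rewrite -ltnS.
Qed.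

(** Inverses modulo X^(N+1) are unique: p = p(qr) = (pq)r = r there. *)
Lemma eq_upto_inv N p q r s : eq_upto N (p * q) 1 -> eq_upto N (r * s) 1 ->
  eq_upto N q s -> eq_upto N p r.
Proof.
move=> pq rs qs i iN; have rq : eq_upto N (q * r) 1.
  by move=> j jN; rewrite (eq_uptoM qs (fun _ _ => erefl)) // mulrC rs.
transitivity ((p * (q * r))`_i).
  by rewrite (eq_uptoM (fun _ _ => erefl) rq) // mulr1.
by rewrite mulrA (eq_uptoM pq (fun _ _ => erefl)) // mul1r.
Qed.

(** States S = X p' / p modulo X^(N+1) without dividing. *)
Definition log_derivative (N : nat) (p S : {poly R}) : Prop :=
  eq_upto N ('X * p^`()) (p * S).

Lemma log_derivative_prod N (I : Type) (s : seq I) (P : pred I)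
    (F S : I -> {poly R}) :
  (forall i, P i -> log_derivative N (F i) (S i)) ->
  log_derivative N (\prod_(i <- s | P i) F i) (\sum_(i <- s | P i) S i).
Proof.
move=> FS; apply: (big_ind2 (log_derivative N)) => //.
  by move=> i _; rewrite -[1]/(1%:P) derivC !mulr0.
move=> p1 S1 p2 S2 h1 h2 i iN.
have -> : 'X * (p1 * p2)^`() = ('X * p1^`()) * p2 + p1 * ('X * p2^`()).
  by rewrite derivM; ring.
rewrite coefD (eq_uptoM h1 (fun _ _ => erefl)) //.
rewrite (eq_uptoM (fun _ _ => erefl) h2) // -coefD.
by have -> : p1 * S1 * p2 + p1 * (p2 * S2) = p1 * p2 * (S1 + S2) by ring.
Qed.

(** Comparing coefficients of X^(i+1) gives (i+1) p_(i+1) in terms of p_0, ..., p_i alone, because S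
    has no constant term; characteristic 0 allows division by i+1. *)
Lemma log_derivative_inj N (p r S : {poly R}) : p`_0 = r`_0 -> S`_0 = 0 ->
  log_derivative N p S -> log_derivative N r S -> eq_upto N p r.
Proof.
move=> pr0 S0 pS rS i; elim/ltn_ind: i => -[//|i] IHi iN.
have := pS _ iN; have := rS _ iN; rewrite !coefXM !coef_deriv /= => rE pE.
apply: (@mulIf _ i.+1%:R); first by rewrite pnatr_eq0.
rewrite !mulr_natr pE rE !coefM [LHS]big_ord_recr [RHS]big_ord_recr /=.
rewrite subnn S0 !mulr0 !addr0.
by apply: eq_bigr => j _; rewrite IHi // ltnW // (leq_trans _ iN).
Qed.

(** With g = a X^l, the exact value - l g / (1 - g) is expanded as a geometric series. *)
Lemma log_derivative_euler_factor N l (a : R) : (0 < l)%N ->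
  log_derivative N (1 - a *: 'X^l)
    (- \sum_(1 <= k < N.+1) (l%:R * a ^+ k) *: 'X^(k * l)).
Proof.
move=> l0 i iN; set g := a *: 'X^l.
have -> : \sum_(1 <= k < N.+1) (l%:R * a ^+ k) *: 'X^(k * l) =
    l%:R *: (g * \sum_(k < N) g ^+ k).
  rewrite big_add1 big_mkord big_distrr scaler_sumr /=; apply: eq_bigr => k _.
  by rewrite -exprS exprZn -exprM mulnC -scalerA.
(* The truncated series telescopes; the error l g^(N+1) has degree at least l(N+1) > N. *)
have -> : (1 - g) * - (l%:R *: (g * \sum_(k < N) g ^+ k)) =
    l%:R *: (g ^+ N.+1 - g).
  rewrite mulrN -scalerAr -scalerN; congr (_ *: _).
  have gN : 1 - g ^+ N = (1 - g) * \sum_(k < N) g ^+ k.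
    rewrite -[in LHS](expr1n _ N) subrXX; congr (_ * _).
    by apply: eq_bigr => k _; rewrite expr1n mul1r.
  by rewrite mulrCA -gN exprS; ring.
rewrite derivB -[1]/(1%:P) derivC sub0r derivZ derivXn mulrN -scalerAr.
rewrite -[X in 'X * X]mulr_natl mulrCA -exprS prednK //.
rewrite !coefZ coefN coefB exprZn -exprM !coefZ !coefXn ltn_eqF; last first.
  by rewrite (leq_ltn_trans iN) // -{1}[N.+1]mul1n leq_mul2r l0 orbT.
by rewrite mulr0 sub0r mulr_natl coefMn coefXn mulrN mulrCA mulr_natl.
Qed.

Lemma coef_log_euler_factor N l n (a : R) : (0 < l)%N -> (n <= N)%N ->
  (\sum_(1 <= k < N.+1) (l%:R * a ^+ k) *: 'X^(k * l))`_n =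
  if (0 < n)%N && (l %| n)%N then l%:R * a ^+ (n %/ l) else 0.
Proof.
move=> l0 nN; rewrite coef_sum; under eq_bigr do rewrite coefZ coefXn.
case: ifP => [/andP[n0 /dvdnP[k nE]]|nl].
  have k0 : (0 < k)%N by move: n0; rewrite nE muln_gt0 => /andP[].
  rewrite (bigD1_seq k) ?iota_uniq //=; last first.
    by rewrite mem_index_iota k0 ltnS (leq_trans _ nN) // nE leq_pmulr.
  rewrite nE eqxx mulnK // mulr1 big1 ?addr0 // => j jk.
  by rewrite eqn_pmul2r // eq_sym (negPf jk) mulr0.
rewrite big_nat big1 // => k /andP[k0 _]; case: eqP => [nE|_]; last first.
  by rewrite mulr0.
by rewrite nE muln_gt0 k0 l0 dvdn_mull in nl.
Qed.

End TruncatedSeries.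

(** * The traces determine the zeta function *)

Section ZetaTraces.

Definition zeta_denominator (X : weighted_graph) (N : nat) : {poly rat} :=
  \prod_(1 <= l < N.+1) \prod_(C in prime_cycles X l)
     (1 - cycle_weight C *: 'X^l).

(** Each prime cycle C of length l contributes l w(C)^(n/l) for every positive multiple n of l, and
    these add up to the n-th trace. The constant term must be 0, whereas the trace of the identity
    is the number of edges. *)
Lemma log_derivative_zeta_denominator (X : weighted_graph) (N : nat) :
  log_derivative N (zeta_denominator X N)
    (\poly_(n < N.+1)
       (- (if n is 0 then 0 else power_trace (@edge_kernel X) n))).
Proof.
pose S l (C : {set l.-tuple (edge X)}) : {poly rat} :=
  - \sum_(1 <= k < N.+1) (l%:R * cycle_weight C ^+ k) *: 'X^(k * l).
have QS : log_derivative N (zeta_denominator X N)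
    (\sum_(1 <= l < N.+1 | (0 < l)%N) \sum_(C in prime_cycles X l) S l C).
  (* Positivity of [l] is moved into the predicate so that [log_derivative_prod] hands it to each
     factor. *)
  have -> : zeta_denominator X N =
      \prod_(1 <= l < N.+1 | (0 < l)%N) \prod_(C in prime_cycles X l)
        (1 - cycle_weight C *: 'X^l).
    rewrite /zeta_denominator big_nat_cond [RHS]big_nat_cond.
    by apply: eq_bigl => l; case: l.
  apply: log_derivative_prod => l l0; apply: log_derivative_prod => C _.
  exact: log_derivative_euler_factor.
move=> i iN; rewrite QS //; apply: eq_uptoM (iN) => // n nN.
rewrite coef_poly ltnS nN coef_sum.
under eq_bigr => l l0.
  rewrite coef_sum; under eq_bigr do rewrite coefN coef_log_euler_factor //.
  over.
case: n nN => [|n] nN /=.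
  by rewrite oppr0 big1 // => l _; rewrite big1 // => C _; rewrite oppr0.
rewrite (@power_trace_prime_cycles X n.+1 N) // -sumrN big_mkcond.
rewrite [RHS]big_mkcond big_nat [RHS]big_nat; apply: eq_bigr => l /andP[-> _].
rewrite sumrN; case: ifP => // _; last by rewrite big1 ?oppr0.
Qed.

(** Equal traces give equal logarithmic derivatives, hence equal denominators up to any order N,
    hence equal inverses. *)
Lemma zeta_trace (X Y : weighted_graph) :
  (forall n, (0 < n)%N ->
    power_trace (@edge_kernel X) n = power_trace (@edge_kernel Y) n) ->
  forall n, zeta X n = zeta Y n.
Proof.
move=> XY N.
have zQ Z : eq_upto N ((\poly_(n < N.+1) zeta Z n) * zeta_denominator Z N) 1.
  by move=> i iN; rewrite zeta_euler_product // coef1.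
have Q0 Z : (zeta_denominator Z N)`_0 = 1.
  rewrite coef0_prod big_nat big1 // => l /andP[l0 _].
  rewrite coef0_prod big1 //.
  by move=> C _; rewrite coefB coefZ coefXn coef1 (ltn_eqF l0) mulr0 subr0.
have QXY : eq_upto N (zeta_denominator X N) (zeta_denominator Y N).
  apply: (log_derivative_inj _ _ (@log_derivative_zeta_denominator X N)).
  - by rewrite !Q0.
  - by rewrite coef_poly oppr0.
  have -> : \poly_(n < N.+1)
      (- (if n is 0 then 0 else power_trace (@edge_kernel X) n)) =
      \poly_(n < N.+1)
      (- (if n is 0 then 0 else power_trace (@edge_kernel Y) n)).
    apply/polyP => i; rewrite !coef_poly; case: ifP => // _.
    by case: i => // i; rewrite XY.
  exact: (@log_derivative_zeta_denominator Y N).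
by have := eq_upto_inv (zQ X) (zQ Y) QXY (leqnn N); rewrite !coef_poly ltnSn.
Qed.

End ZetaTraces.

(** * The weighted path with three vertices *)

Section Segment.

(* The center is [None] and the two leaves are [Some b]; the edge [(b, true)]
   goes from the center to [Some b], and [(b, false)] is its inverse. *)
Definition segment_source (e : bool * bool) : option bool :=
  if e.2 then None else Some e.1.

Definition segment_target (e : bool * bool) : option bool :=
  if e.2 then Some e.1 else None.

Definition segment_inv (e : bool * bool) : bool * bool := (e.1, ~~ e.2).

Lemma segment_invK : involutive segment_inv.
Proof. by case=> b []. Qed.

Lemma segment_inv_neq e : segment_inv e != e.
Proof. by case: e => -[] []. Qed.

Lemma segment_source_inv e : segment_source e = segment_target (segment_inv e).
Proof. by case: e => b []. Qed.

Definition segment : graph :=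
  Graph segment_invK segment_inv_neq segment_source_inv.

Lemma segment_connected : connected_graph segment.
Proof.
have adj (e : edge segment) : connect (@adjacent segment) (source e) (target e).
  by apply/connect1/existsP; exists e; rewrite !eqxx.
have to_center x : connect (@adjacent segment) x None.
  by case: x => [b|]; [exact: (adj (b, false)) | exact: connect0].
have from_center x : connect (@adjacent segment) None x.
  by case: x => [b|]; [exact: (adj (b, true)) | exact: connect0].
split; first by exists; exact: None.
by move=> x y; apply: connect_trans (to_center x) (from_center y).
Qed.

Variable p : bool -> nat.

(** The edge from the center to leaf [b] is to have weight [(p b).+1], so the two weights add up to
    [q.+1]. The successors make the cyclic groups ['I_(p b).+1] available for every [p]. *)
Let q := (p true + p false).+1.

(** The group of an edge at leaf [b] is the factor of the center group labelled [~~ b], so its index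
    in the center is [(p b).+1]. The extra factor at the leaf produces the index [q.+1]. *)
Definition segment_vgroup (x : vertex segment) : finGroupType :=
  if x is Some b then ('I_q.+1 * 'I_(p (~~ b)).+1)%type
  else ('I_(p true).+1 * 'I_(p false).+1)%type.

Definition segment_egroup (e : edge segment) : finGroupType :=
  'I_(p (~~ e.1)).+1.

Definition segment_mono (e : edge segment) :
    {morphism [set: segment_egroup e] >-> segment_vgroup (target e)} :=
  match e with
  | (b, true) => pair1g_morphism 'I_q.+1 'I_(p (~~ b)).+1
  | (true, false) => pair1g_morphism 'I_(p true).+1 'I_(p false).+1
  | (false, false) => pairg1_morphism 'I_(p true).+1 'I_(p false).+1
  end.

Lemma segment_mono_inj e : ('injm (segment_mono e))%g.
Proof. by case: e => -[] []; apply: injm_pair1g || apply: injm_pairg1. Qed.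

Definition segment_groups : graph_of_groups :=
  @GraphOfGroups segment segment_connected segment_vgroup segment_egroup
    (fun=> erefl) segment_mono segment_mono_inj.

Local Notation X := (induced segment_groups).

Lemma weight_from_center b : @weight X (b, true) = (p b).+1%:R.
Proof.
by case: b; rewrite /= card_prod !card_ord natrM ?mulfK ?[_ * _ / _]mulrAC
  ?mulfK ?pnatr_eq0 // mulfV ?mul1r // pnatr_eq0.
Qed.

Lemma weight_to_center b : @weight X (b, false) = q.+1%:R.
Proof. by rewrite /= card_prod !card_ord natrM mulfK // pnatr_eq0. Qed.

Lemma sum_segment_edge (F : edge X -> rat) :
  \sum_e F e =
  F (true, true) + F (true, false) + F (false, true) + F (false, false).
Proof.
rewrite -[LHS]/(\sum_(e : bool * bool) F e).
have -> : \sum_(e : bool * bool) F e = \sum_e F (e.1, e.2).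
  by apply: eq_bigr => -[].
by rewrite -(pair_bigA _ (fun b o => F (b, o))) /= big_bool !big_bool /= addrA.
Qed.

Lemma segment_regular : regular q.+1 segment_groups.
Proof.
move=> x; rewrite big_mkcond sum_segment_edge.
rewrite !weight_from_center !weight_to_center.
case: x => [[]|] /=; rewrite ?add0r ?addr0 // -natrD /q; congr _%:R.
by rewrite addnS.
Qed.

(** A path that reaches a leaf must turn back, at weight (q + 1) - 1. *)
Lemma kernel_op_from_center h b :
  kernel_op (@edge_kernel X) h (b, true) = q%:R * h (b, false).
Proof.
rewrite /kernel_op sum_segment_edge /edge_kernel /transition_weight.
rewrite !weight_from_center !weight_to_center.
by case: b => /=; rewrite ?mul0r ?add0r ?addr0 // -[q.+1]addn1 natrD addrK.
Qed.

(** At the center a path either backtracks, losing 1 from the weight, or goes on to the other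
    leaf. *)
Lemma kernel_op_to_center h b :
  kernel_op (@edge_kernel X) h (b, false) =
  (p b)%:R * h (b, true) + (p (~~ b)).+1%:R * h (~~ b, true).
Proof.
rewrite /kernel_op sum_segment_edge /edge_kernel /transition_weight.
rewrite !weight_from_center !weight_to_center.
by case: b => /=; rewrite ?mul0r ?add0r ?addr0 // -!natr1; ring.
Qed.

(* Cayley-Hamilton for the transition operator. *)
Lemma iter4_kernel_op h e :
  iter 4 (kernel_op (@edge_kernel X)) h e =
  q%:R * (q%:R - 1) * iter 2 (kernel_op (@edge_kernel X)) h e + q%:R ^+ 3 * h e.
Proof.
(* The operator exchanges the edges leaving the center with those entering it. On either pair its
   square is q times the matrix with rows (a, b+1) and (a+1, b), where a = [p true] and b =
   [p false]; its trace is q(q-1) and its determinant -q^3. *)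
case: e => b []; rewrite /= !(kernel_op_from_center, kernel_op_to_center);
  rewrite ?negbK -!natr1 natrD; case: b => /=; ring.
Qed.

Lemma power_trace_segmentD4 n :
  power_trace (@edge_kernel X) n.+4 =
  q%:R * (q%:R - 1) * power_trace (@edge_kernel X) n.+2 +
  q%:R ^+ 3 * power_trace (@edge_kernel X) n.
Proof.
rewrite /power_trace !big_distrr -big_split /=; apply: eq_bigr => e _.
exact: iter4_kernel_op.
Qed.

Lemma power_trace_segment0 : power_trace (@edge_kernel X) 0 = 4%:R.
Proof. by rewrite /power_trace sum_segment_edge. Qed.

(** Odd traces vanish because edges leaving and entering the center alternate along a path. *)
Lemma power_trace_segment1 : power_trace (@edge_kernel X) 1 = 0.
Proof.
rewrite /power_trace sum_segment_edge /=.
by rewrite !(kernel_op_from_center, kernel_op_to_center) /= !mulr0 !addr0.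
Qed.

(** Only backtracking at both ends closes up in two steps, so [p] enters through the sum
    [p true + p false] = q - 1 alone. *)
Lemma power_trace_segment2 :
  power_trace (@edge_kernel X) 2 = 2%:R * q%:R * (q%:R - 1).
Proof.
rewrite /power_trace sum_segment_edge /=.
rewrite !(kernel_op_from_center, kernel_op_to_center) /=.
by rewrite -!natr1 natrD; ring.
Qed.

Lemma power_trace_segment3 : power_trace (@edge_kernel X) 3 = 0.
Proof.
rewrite /power_trace sum_segment_edge /=.
by rewrite !(kernel_op_from_center, kernel_op_to_center) /= !(mulr0, addr0).
Qed.

End Segment.

(** * Equal zeta functions and the non-isomorphic pair *)

Lemma zeta_segment (p p' : bool -> nat) :
  (p true + p false = p' true + p' false)%N ->
  forall n, zeta (induced (segment_groups p)) n =
            zeta (induced (segment_groups p')) n.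
Proof.
(* The induction includes n = 0, since the recurrence at n = 4 reaches back to the trace of the
   identity. *)
move=> pp'; apply: zeta_trace => n _; elim/ltn_ind: n => -[|[|[|[|n]]]] IHn.
- by rewrite !power_trace_segment0.
- by rewrite !power_trace_segment1.
- by rewrite !power_trace_segment2 pp'.
- by rewrite !power_trace_segment3.
- by rewrite !power_trace_segmentD4 pp' !IHn // ltnW // ltnW.
Qed.

Theorem proposition1p2 (q : nat) (hq : (3 <= q)%N) :
  exists G G' : graph_of_groups,
    [/\ regular q.+1 G,
        regular q.+1 G',
        ~ weighted_isomorphic (induced G) (induced G')
      & forall n : nat, zeta (induced G) n = zeta (induced G') n].
Proof.
case: q hq => [|[|[|k]]] // _.
(* Here q = k + 3: the weights leaving the center are 1 and q for [p], and 2 and q - 1 for [p']. *)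
pose p b := if b then 0%N else k.+2; pose p' b := if b then 1%N else k.+1.
exists (segment_groups p), (segment_groups p').
split; [exact: segment_regular | exact: segment_regular |
  | exact: zeta_segment].
(* The edge of weight 1 has no possible image: the weights on the other side are 2, q - 1 and q + 1,
   all at least 2. *)
case=> f [g [_ _ /(_ (true, true)) [_ _ _]]]; rewrite weight_from_center.
case: (g _) => b []; rewrite ?weight_from_center ?weight_to_center.
  by move/eqP; rewrite eqr_nat; case: b.
by move/eqP; rewrite eqr_nat.
Qed.
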